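(* Let $G$ be a finitely generated group with a finite symmetric generating set $S$, and assume the action of $G$ on the standard probability measure space $(X,\mu)$ is measure-preserving and essentially free. Then $\mathcal{I}_{(G,S)\curvearrowright X}(n)\ge \mathcal{I}_G(n)$ for all $n$ large enough.
   Context: A generating set $S$ of $G$ is symmetric if $s\in S$ implies $s^{-1}\in S$. The action is essentially free if $\mu(\{x\in X: gx=x\})=0$ for every non-trivial $g\in G$. For finite $F\subset G$, $\partial F=\{g\in F: sg\notin F\text{ for some } s\in S\}$, and the isoperimetric profile of $G$ (with respect to $S$) is $\mathcal{I}_G(n)=\inf\{|\partial F|/|F| : F\subset G,\ 1\le |F|\le n\}$. Let $\mathcal{R}\subset X\times X$ be the orbit equivalence relation of the action. A subequivalence relation of $\mathcal{R}$ is a subset of $\mathcal{R}$ that is itself an equivalence relation on $X$; all subequivalence relations are assumed measurable as subsets of $X\times X$. For such $\theta\subset\mathcal{R}$, $[x]_\theta$ is the class of $x$, $|\theta|$ is the maximal size of an equivalence class of $\theta$, and $$\partial\theta=\{x\in X : sx\notin [x]_\theta \text{ for some } s\in S\}.$$ The isoperimetric profile of the action is $$\mathcal{I}_{(G,S)\curvearrowright X}(n)=\inf\{\mu(\partial\theta) : \theta\subset\mathcal{R}\text{ a measurable subequivalence relation with } |\theta|\le n\}.$$ *)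

(* Defs.v *)
From HB Require Import structures.
From mathcomp Require Import all_boot all_order all_algebra finmap.
From mathcomp Require Import all_classical all_reals all_analysis.

Set Implicit Arguments.
Unset Strict Implicit.
Unset Printing Implicit Defensive.

Local Open Scope classical_set_scope.

Section Group.
Context {G : groupType}.
Implicit Types S F : {fset G}.

Definition symmetric_set S := forall s, s \in S -> (s^-1)%g \in S.

Definition generating_set S :=
  forall H : {pred G}, group_closed H -> {subset S <= H} -> forall g, g \in H.

Definition fboundary S F : {fset G} :=
  [fset g in F | has (fun s => (s * g)%g \notin F) S]%fset.

(* The infimum is taken in the extended reals, hence is +oo for n = 0. *)
Definition group_profile (R : realType) S (n : nat) : \bar R :=
  ereal_inf [set ((#|` fboundary S F|%:R / #|` F|%:R)%R)%:E
            | F in [set F : {fset G} | 1 <= #|` F| <= n]%N].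

End Group.

Section StandardBorel.
Context {R : realType}.

Definition complete_metric (P : metricType R) :=
  forall F : set_system P, ProperFilter F -> cauchy F ->
    exists p : P, F --> p.

Definition separable_space (P : topologicalType) :=
  exists2 D : set P, countable D & dense D.

Definition standard_borel d (X : measurableType d) :=
  exists (P : metricType R) (f : X -> P),
    [/\ complete_metric P, separable_space P, bijective f &
        @measurable d X = [set f @^-1` B | B in <<s @open P >>]].

End StandardBorel.
Arguments standard_borel R {d} X.

Section Action.
Context {G : groupType} {R : realType} {d : measure_display}
  {X : measurableType d}.
Variables (mu : probability X R) (act : G -> X -> X).

Definition group_action :=
  (forall x, act 1%g x = x) /\
  (forall g h x, act (g * h)%g x = act g (act h x)).

Definition measure_preserving_action :=
  forall g, measurable_fun [set: X] (act g) /\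
    forall A, measurable A -> mu (act g @^-1` A) = mu A.

Definition essentially_free :=
  forall g, g != 1%g -> mu [set x | act g x = x] = 0%E.

Definition orbit_relation : set (X * X) :=
  [set xy | exists g, xy.2 = act g xy.1].

Definition equivalence_on (theta : set (X * X)) :=
  [/\ forall x, theta (x, x),
      forall x y, theta (x, y) -> theta (y, x) &
      forall x y z, theta (x, y) -> theta (y, z) -> theta (x, z)].

Definition measurable_subequivalence (theta : set (X * X)) :=
  [/\ theta `<=` orbit_relation, equivalence_on theta & measurable theta].

(* [xsection theta x] is the class of x; [counting] is +oo on infinite sets. *)
Definition max_class_size (theta : set (X * X)) : \bar R :=
  ereal_sup [set counting (xsection theta x) | x in [set: X]].

Definition rel_boundary (S : {fset G}) (theta : set (X * X)) : set X :=
  [set x | exists2 s, s \in S & ~ xsection theta x (act s x)].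

Definition action_profile (S : {fset G}) (n : nat) : \bar R :=
  ereal_inf [set mu (rel_boundary S theta)
            | theta in [set theta | measurable_subequivalence theta /\
                         (max_class_size theta <= (n%:R)%:E)%E]].

End Action.

(* Main.v *)
(* For a subequivalence relation [theta] with classes of size at most [n] and a
   free point [x], the set F_x of all g such that (x, gx) lies in [theta] is in
   bijection with the class of [x], and its boundary corresponds to the part of
   the class lying in the boundary of [theta]; so that part has proportion at
   least the group profile at [n]. Letting every boundary point spread its unit
   mass evenly over its class, [x] receives exactly this proportion. Since the
   action preserves [mu], the mean mass received equals the mean mass sent,
   which is the measure of the boundary of [theta]. *)
Require Import Defs.
From HB Require Import structures.
From mathcomp Require Import all_boot all_order all_algebra finmap.
From mathcomp Require Import all_classical all_reals all_analysis.
From mathcomp Require Import measurable_realfun.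

Local Open Scope classical_set_scope.

Import Order.TTheory GRing.Theory Num.Theory.

(** * Countability of a finitely generated group *)

(** Words over [S] represent a subgroup, closed under inverses by symmetry, so they exhaust [G];
    words over a finite alphabet are countably many. *)
Lemma generating_countable (G : groupType) (S : {fset G}) :
  symmetric_set S -> generating_set S -> countable [set: G].
Proof.
move=> Ssym Sgen.
pose word (w : seq S) : G := (\prod_(s <- w) val s)%g.
pose wordT := [set word w | w in [set: seq S]].
have wordM w1 w2 : (word w1 * word w2)%g = word (w1 ++ w2).
  by rewrite /word big_cat.
have wordV w : exists w', (word w)^-1%g = word w'.
  elim: w => [|s w [w' ww']].
    by exists [::]; rewrite /word big_nil invg1.
  have sV := Ssym _ (valP s).
  exists (w' ++ [:: [` sV]%fset]).
  by rewrite -wordM -ww' /word big_cons big_seq1 invgM.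
suff <- : wordT = [set: G].
  exact: card_le_trans (card_image_le _ _) (countableP _).
apply/seteqP; split => // g _.
have : g \in mem wordT.
  apply: Sgen; last first.
    move=> s sS; rewrite inE; exists [:: [` sS]%fset] => //.
    by rewrite /word big_seq1.
  split; first by rewrite inE; exists [::] => //; rewrite /word big_nil.
  move=> g1 g2; rewrite !inE => -[w1 _ <-] [w2 _ <-].
  have [w' ->] := wordV w2.
  by exists (w1 ++ w') => //; rewrite wordM.
by rewrite inE.
Qed.

(** * Separation of points in standard Borel spaces *)

Section separation.
Context {R : realType}.

Lemma metric_ball_open (P : metricType R) (p : P) (r : R) : open (ball p r).
Proof.
rewrite openE => x; rewrite ballEmdist /= => pxr.
apply/nbhs_ballP; exists (r - mdist p x)%R; first by rewrite /= subr_gt0.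
move=> y; rewrite !ballEmdist /= => xy.
rewrite (le_lt_trans (metric_triangle p x y))//.
by rewrite -ltrBrDl.
Qed.

(** Balls of radius 1/(q+1) around the points of a countable dense set separate the points of [P];
    they are pulled back along [f]. *)
Lemma standard_borel_separating d (X : measurableType d) :
  standard_borel R X ->
  exists U : nat * nat -> set X, (forall i, measurable (U i)) /\
    forall x y, x <> y -> exists i, U i x /\ ~ U i y.
Proof.
move=> [P [f [_ [D /countable_injP[j jinj] Ddense] fbij measE]]].
pose V (i : nat * nat) : set P :=
  \bigcup_(p in D `&` [set p | j p = i.1]) ball p i.2.+1%:R^-1.
exists (fun i => f @^-1` V i); split => [i|x y xy].
  rewrite measE; exists (V i) => //; apply: sub_gen_smallest.
  by apply: bigcup_open => p _; exact: metric_ball_open.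
have fxy : (0 < mdist (f x) (f y))%R.
  by rewrite mdist_gt0; apply/eqP => /(bij_inj fbij).
(* A radius below half the distance keeps a ball containing [f x] from also containing [f y]. *)
have [q fq] : exists q : nat, (q.+1%:R^-1 < mdist (f x) (f y) / 2 :> R)%R.
  have e0 : (0 < mdist (f x) (f y) / 2)%R by rewrite divr_gt0.
  have [q _ qP] := near_infty_natSinv_lt (PosNum e0).
  by exists q; apply: (qP q) => /=.
have q0 : (0 < q.+1%:R^-1 :> R)%R by rewrite invr_gt0.
have [p [/ball_sym pB pD]] : ball (f x) q.+1%:R^-1 `&` D !=set0.
  apply: Ddense; last exact: metric_ball_open.
  by exists (f x); exact: ballxx.
exists (j p, q); split; rewrite /V /=.
  by exists p.
(* As [j] is injective on [D], the only ball in [V (j p, q)] is the one around [p]. *)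
move=> [p' [/= p'D jp'] p'B].
have {p' jp' p'D p'B} pB' : ball p q.+1%:R^-1 (f y).
  by rewrite -(jinj p' p) ?inE.
have := ball_triangle (ball_sym pB) pB'; rewrite ballEmdist /=.
by apply/negP; rewrite -leNgt; apply/ltW; rewrite [ltRHS]splitr ltrD.
Qed.

(** The complement is a countable union: some [U i] contains [f y] but not [g y]. This serves to
    measure fixed-point sets. *)
Lemma measurable_eq_set d d' (Y : measurableType d') (X : measurableType d)
    (f g : Y -> X) : standard_borel R X ->
  measurable_fun setT f -> measurable_fun setT g ->
  measurable [set y | f y = g y].
Proof.
move=> /standard_borel_separating[U [mU Usep]] mf mg.
rewrite -[X in measurable X]setCK; apply: measurableC.
rewrite (_ : ~` _ = \bigcup_i ((f @^-1` U i) `&` ~` (g @^-1` U i))).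
  apply: countable_bigcupT_measurable => // i; apply: measurableI.
    by rewrite -[X in measurable X]setTI; exact: mf.
  by apply: measurableC; rewrite -[X in measurable X]setTI; exact: mg.
apply/seteqP; split => y /=.
  by move=> /Usep[i [? ?]]; exists i.
by move=> [i _ [/= Uf Ug]] fg; apply: Ug; rewrite /preimage/= -fg.
Qed.

End separation.

(** * Sums over countable index types *)

(** Padding by [None] covers finite and even empty types. *)
Lemma countable_enum (T : Type) : countable [set: T] ->
  exists (j : T -> nat) (e : nat -> option T), pcancel j e /\ ocancel e j.
Proof.
move=> /countable_injP[j jinj].
have jI : injective j by move=> x y; apply: jinj; rewrite inE.
have /choice[e eP] : forall n, exists o : option T,
    (forall t, j t = n -> o = Some t) /\ (forall t, o = Some t -> j t = n).
  move=> n; have [[t jt]|nt] := pselect (exists t, j t = n).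
    exists (Some t); split => [u|u [<-//]].
    by rewrite -jt => /jI ->.
  by exists None; split => // t jt; exfalso; apply: nt; exists t.
exists j, e; split=> [t|n]; first exact: (eP _).1.
by case en : (e n) => [t|//]; exact: (eP n).2.
Qed.

Section countable_sum.
Local Open Scope ring_scope.
Local Open Scope ereal_scope.
Context {R : realType} {T : choiceType}.
Hypothesis Tcount : countable [set: T].

(** One enumeration serves every [f], so a sum depending on a point of [X] becomes a series of
    functions. *)
Lemma esum_nneseries : exists e : nat -> option T,
  forall f : T -> \bar R, (forall t, 0 <= f t) ->
  \esum_(t in [set: T]) f t = \sum_(n <oo) oapp f 0 (e n).
Proof.
have [j [e [je ej]]] := countable_enum _ Tcount.
exists e => f f0.
rewrite nneseries_esumT; last by move=> n; case: (e n) => /=.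
under eq_esum do rewrite -[f _]/(oapp f 0 (Some _)) -je.
rewrite -(esum_image _ _ (fun n => oapp f 0 (e n))); last first.
  by move=> x y _ _; exact: pcan_inj je _ _.
(* Indices outside the range of [j] are sent to [None] and contribute 0. *)
rewrite esum_mkcond; apply: eq_esum => n _.
case: ifPn => // /negP; rewrite inE/= => nj.
case en : (e n) => [t|//]; exfalso; apply: nj; exists t => //.
by have := ej n; rewrite en.
Qed.

Context {d : measure_display} {X : measurableType d}.
Variables (mu : {measure set X -> \bar R}) (f : T -> X -> \bar R).
Hypotheses (f0 : forall t x, 0 <= f t x)
  (mf : forall t, measurable_fun [set: X] (f t)).

Let mof (o : option T) : measurable_fun [set: X] (fun x => oapp (f ^~ x) 0 o).
Proof. by case: o => [t|]; [exact: mf|exact: measurable_cst]. Qed.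

Let of0 (o : option T) x : 0 <= oapp (f ^~ x) 0 o.
Proof. by case: o => [t|//]; exact: f0. Qed.

Lemma measurable_esum :
  measurable_fun [set: X] (fun x => \esum_(t in [set: T]) f t x).
Proof.
have [e eE] := esum_nneseries.
under eq_fun do rewrite eE//.
apply: (@ge0_emeasurable_sum _ _ _ _ (fun n x => oapp (f ^~ x) 0 (e n)) xpredT).
  by move=> *; exact: of0.
by move=> *; exact: mof.
Qed.

Lemma integral_esum : \int[mu]_x (\esum_(t in [set: T]) f t x) =
  \esum_(t in [set: T]) \int[mu]_x f t x.
Proof.
have [e eE] := esum_nneseries.
under eq_integral do rewrite eE//.
rewrite integral_nneseries// eE; last first.
  by move=> t; apply: integral_ge0 => x _; exact: f0.
apply: eq_eseriesr => n _; case: (e n) => //=.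
exact: integral0.
Qed.

End countable_sum.

(** * Mass transport *)

Section mass_transport.
Local Open Scope ring_scope.
Local Open Scope ereal_scope.
Context {G : groupType} {R : realType} {d : measure_display}
  {X : measurableType d}.
Variables (mu : probability X R) (act : G -> X -> X).
Hypotheses (Gcount : countable [set: G])
  (act_mp : measure_preserving_action mu act).

Lemma measure_preserving_integral g (f : X -> \bar R) :
  (forall x, 0 <= f x) -> measurable_fun [set: X] f ->
  \int[mu]_x f (act g x) = \int[mu]_x f x.
Proof.
move=> f0 mf; have [mg gE] := act_mp g.
rewrite -[LHS](@ge0_integral_pushforward _ _ _ _ _ _ mg mu setT f)//.
by apply: eq_measure_integral => A mA _; exact: gE.
Qed.

(* The mass sent by [x] to [act g x] is [f g x]. *)
Lemma mass_transport (f : G -> X -> \bar R) :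
  (forall g x, 0 <= f g x) -> (forall g, measurable_fun [set: X] (f g)) ->
  \int[mu]_x (\esum_(g in [set: G]) f g x) =
  \int[mu]_x (\esum_(g in [set: G]) f g^-1%g (act g x)).
Proof.
move=> f0 mf.
rewrite !integral_esum//; last first.
  by move=> g; apply: measurableT_comp => //; exact: (act_mp g).1.
(* Reindexed by inverses, the left sum matches the right one term by term, since invariance of [mu]
   removes [act g]. *)
rewrite (@reindex_esum _ _ _ setT setT (fun g : G => g^-1%g)).
  by apply: eq_esum => g _; rewrite (measure_preserving_integral _ (f g^-1%g)).
split => //; first by move=> x y _ _; exact: invg_inj.
by move=> x _; exists x^-1%g => //=; rewrite invgK.
Qed.

End mass_transport.

Lemma esum_indic (R : realType) (T : choiceType) (A : set T) (k : R) :
  finite_set A -> (0 <= k)%R ->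
  (\esum_(t in [set: T]) (\1_A t * k)%:E = (#|` fset_set A|%:R * k)%:E)%R.
Proof.
move=> finA k0.
transitivity (\esum_(t in A) k%:E)%R.
  rewrite [RHS]esum_mkcond; apply: eq_esum => t _.
  by rewrite indicE; case: ifPn; rewrite ?mul1r ?mul0r.
rewrite esum_fset// fsbig_finite//= sumEFin big_const_seq count_predT.
by rewrite iter_addr_0 mulr_natl.
Qed.

(** * Classes pulled back to the group *)

Section class_translates.
Context {G : groupType} {R : realType} {d : measure_display}
  {X : measurableType d}.
Variables (act : G -> X -> X) (theta : set (X * X)) (S : {fset G}).
Hypotheses (actG : group_action act) (theta_eq : equivalence_on theta).
Implicit Types (x : X) (g h : G).

Let act1 x : act 1%g x = x. Proof. exact: actG.1. Qed.
Let actM g h x : act (g * h)%g x = act g (act h x). Proof. exact: actG.2. Qed.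

Definition class_translates x : set G := [set g | theta (x, act g x)].

Definition boundary_translates x : set G :=
  class_translates x `&` [set g | rel_boundary act S theta (act g x)].

Lemma class_translates1 x : class_translates x 1%g.
Proof. by rewrite /class_translates/= act1; case: theta_eq. Qed.

Lemma class_translatesV g x :
  class_translates (act g x) g^-1%g <-> class_translates x g.
Proof.
rewrite /class_translates/= -actM mulVg act1.
by case: theta_eq => _ sym _; split => /sym.
Qed.

Lemma class_translates_act g h x : class_translates x g ->
  class_translates (act g x) h <-> class_translates x (h * g)%g.
Proof.
rewrite /class_translates/= actM => xg; case: theta_eq => _ sym trans.
by split; apply: trans => //; apply: sym.
Qed.

(** For [g] in F_x, the point [act s (act g x)] leaves the class of [act g x] exactly when [s * g]
    lies outside F_x. *)
Lemma fboundary_class_translates x : finite_set (class_translates x) ->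
  fboundary S (fset_set (class_translates x)) = fset_set (boundary_translates x).
Proof.
move=> finx; have finb : finite_set (boundary_translates x).
  by apply: sub_finite_set finx => g [].
apply/fsetP => g; rewrite !inE/= !in_fset_set//.
apply/andP/idP.
  rewrite !inE => -[xg /hasP[s sS]]; rewrite in_fset_set// notin_setE => sg.
  split => //; exists s => //; rewrite /xsection/= inE => gsg.
  by apply: sg; apply/class_translates_act.
rewrite inE => -[xg [s sS sg]]; split; first by rewrite inE.
apply/hasP; exists s => //; rewrite in_fset_set// notin_setE => xsg.
by apply: sg; rewrite /xsection/= inE; apply/(class_translates_act _ s _ xg).
Qed.

Definition free_point x := forall g, g != 1%g -> act g x <> x.

(** Freeness at [x] makes the orbit map injective, so F_x embeds into the class of [x]; it contains
    1. *)
Lemma card_class_translates x n : free_point x ->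
  (max_class_size theta <= (n%:R : R)%:E)%E ->
  finite_set (class_translates x) /\
  (1 <= #|` fset_set (class_translates x)| <= n)%N.
Proof.
move=> xfree thetan.
have act_inj : injective (act ^~ x).
  move=> g h /= gh; have [/eqP|gh1] := eqVneq (h^-1 * g)%g 1%g.
    by rewrite -(inj_eq (mulgI h)) mulVKg mulg1 => /eqP.
  by exfalso; apply: (xfree _ gh1); rewrite actM gh -actM mulVg act1.
have ctE : class_translates x = (act ^~ x) @^-1` (xsection theta x).
  by apply/seteqP; split => g; rewrite /xsection/class_translates/= inE.
have : (counting (xsection theta x) <= (n%:R : R)%:E)%E.
  by apply: le_trans thetan; apply: ereal_sup_ubound; exists x.
rewrite /counting; case: asboolP => // finx; rewrite lee_fin ler_nat => xn.
have finc : finite_set (class_translates x).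
  by rewrite ctE; apply: finite_preimage => // g h _ _; exact: act_inj.
split => //; apply/andP; split.
  rewrite cardfs_gt0; apply/fset0Pn; exists 1%g.
  by rewrite in_fset_set// inE; exact: class_translates1.
apply: leq_trans xn; set F := fset_set (class_translates x).
have <- : #|` [fset act g x | g in F]%fset| = #|` F| by rewrite card_imfset.
apply/fsubset_leq_card/fsubsetP => _ /imfsetP[g /= gx ->].
by move: gx; rewrite !in_fset_set// ctE !inE.
Qed.

End class_translates.

(** * Averaging over the space *)

Section averaging.
Local Open Scope ring_scope.
Local Open Scope ereal_scope.
Context {G : groupType} {R : realType} {d : measure_display}
  {X : measurableType d}.
Variables (mu : probability X R) (act : G -> X -> X) (S : {fset G}).
Hypotheses (Gcount : countable [set: G]) (Xstd : standard_borel R X)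
  (actG : group_action act) (act_mp : measure_preserving_action mu act)
  (act_free : essentially_free mu act).

(** Non-free points lie in a countable union of null sets of fixed points. *)
Lemma ae_free_point : {ae mu, forall x, free_point act x}.
Proof.
pose fixed g : set X := if g == 1%g then set0 else [set x | act g x = x].
(* [negligibleP] needs measurability: a null value of [mu] on a non-measurable
   set would say nothing. *)
have mfixed g : measurable (fixed g).
  rewrite /fixed; case: ifP => // _.
  by have [mg _] := act_mp g; apply: (@measurable_eq_set R _ _ _ _ (act g) id).
exists (\bigcup_g fixed g); split.
- exact: countable_bigcupT_measurable.
- have [j [e [je _]]] := countable_enum _ Gcount.
  apply/negligibleP; first exact: countable_bigcupT_measurable.
  apply: (@negligibleS _ _ _ _ (\bigcup_n oapp fixed set0 (e n))).
    by move=> x [g _ gx]; exists (j g) => //; rewrite je.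
  apply: negligible_bigcup => n; case: (e n) => [g|]; last exact: negligible_set0.
  apply/negligibleP; first exact: mfixed.
  by rewrite /= /fixed; case: eqVneq => [_|/act_free//]; rewrite measure0.
- move=> x /= /existsNP[g] /not_implyP[g1 /contrapT gx].
  by exists g => //; rewrite /fixed (negPf g1).
Qed.

Variable theta : set (X * X).
Hypotheses (theta_sub : measurable_subequivalence act theta).

Let theta_eq : equivalence_on theta. Proof. by case: theta_sub. Qed.
Let C x := class_translates act theta x.
Let D := rel_boundary act S theta.

Lemma measurable_class_translates g : measurable [set x | C x g].
Proof.
have [_ _ mtheta] := theta_sub.
have mpair : measurable_fun [set: X] (fun x => (x, act g x)).
  by apply: measurable_fun_pair => //; exact: (act_mp g).1.
by rewrite -[X in measurable X]setTI; exact: mpair.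
Qed.

Lemma measurable_rel_boundary : measurable D.
Proof.
rewrite (_ : D = \bigcup_(s in [set` S]) ~` [set x | C x s]).
  apply: fin_bigcup_measurable => // s _; apply: measurableC.
  exact: measurable_class_translates.
apply/seteqP; split => x.
  by move=> [s sS]; rewrite /xsection/= inE => xs; exists s.
by move=> [s sS xs]; exists s => //; rewrite /xsection/= inE.
Qed.

(** The cardinality of F_x, written as a sum so that it is measurable in [x]; if F_x is infinite, so
    is [N x], and [fine] turns it into 0. *)
Let N x : \bar R := \esum_(g in [set: G]) (\1_(C x) g * 1)%:E.

(* [powR], unlike the inverse, has a measurability lemma. *)
Let w x : R := (fine (N x) `^ (-1))%R.

Let mclass g : measurable_fun [set: X] (fun x => \1_(C x) g : R).
Proof.
rewrite (_ : (fun x => _) = \1_[set x | C x g]).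
  by apply: measurable_indic; exact: measurable_class_translates.
by apply/funext => x; rewrite !indicE; congr (_%:R); apply/idP/idP; rewrite !inE.
Qed.

Let mw : measurable_fun [set: X] w.
Proof.
apply: (measurableT_comp (measurable_powR (-1))).
apply: (measurableT_comp (fine_measurable measurableT)).
apply: measurable_esum => // g; apply/measurable_EFinP.
exact: measurable_funM.
Qed.

Let w_ge0 x : (0 <= w x)%R. Proof. exact: powR_ge0. Qed.

Let w_class x : finite_set (C x) -> w x = (#|` fset_set (C x)|%:R^-1)%R.
Proof. by move=> Cx; rewrite /w /N esum_indic// mulr1 powR_inv1. Qed.

(** [C (act g x)] is [C x] multiplied on the right by the inverse of [g], so the weight is constant
    on classes, at non-free points too. *)
Let w_act g x : C x g -> w (act g x) = w x.
Proof.
move=> xg; rewrite /w; congr (fine _ `^ _)%R; rewrite /N.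
rewrite [RHS](@reindex_esum _ _ _ setT setT (fun h : G => (h * g)%g)).
  apply: eq_esum => h _; rewrite !indicE.
  suff -> : (h \in C (act g x)) = ((h * g)%g \in C x) by [].
  have actE := class_translates_act act theta actG theta_eq _ h _ xg.
  by apply/idP/idP; rewrite !inE => ?; apply/actE.
split => //; first by move=> h k _ _; exact: mulIg.
by move=> h _; exists (h * g^-1)%g => //=; rewrite mulgVK.
Qed.

Lemma group_profile_le_boundary n : max_class_size theta <= (n%:R : R)%:E ->
  group_profile R S n <= mu D.
Proof.
move=> thetan.
have mD := measurable_rel_boundary.
(* A point of [D] sends [w x] to each [act g x] in its class; other points send nothing. *)
pose f g x : \bar R := (\1_(C x) g * (\1_D x * w x))%:E.
have f0 g x : 0 <= f g x by rewrite lee_fin !mulr_ge0.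
have mf g : measurable_fun [set: X] (f g).
  apply/measurable_EFinP; apply: measurable_funM => //.
  by apply: measurable_funM => //; exact: measurable_indic.
(* The mass that [x] receives from [act g x]; constancy of the weight on classes allows [w x]
   here. *)
have fE g x : f g^-1%g (act g x) =
    (\1_(boundary_translates act theta S x) g * w x)%:E.
  rewrite /f !indicE /boundary_translates in_setI.
  have -> : (g^-1%g \in C (act g x)) = (g \in C x).
    have VE := class_translatesV act theta actG theta_eq g x.
    by apply/idP/idP; rewrite !inE => ?; apply/VE.
  have [|_] := boolP (g \in C x); last by rewrite !mul0r.
  by rewrite inE => /w_act ->; rewrite !mul1r.
have profile_ge0 : 0 <= group_profile R S n.
  by apply: le_ereal_inf_tmp => _ [F _ <-]; rewrite lee_fin divr_ge0.
have -> : mu D = \int[mu]_x (\1_D x)%:E by rewrite integral_indic// setIT.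
(* The total mass sent by a free point is 1 on [D] and 0 off it. *)
apply: (@le_trans _ _ (\int[mu]_x \esum_(g in [set: G]) f g x)); last first.
  apply: ae_ge0_le_integral => //.
  - by move=> x _; exact: esum_ge0.
  - exact: measurable_esum.
  - by apply/measurable_EFinP; exact: measurable_indic.
  move: ae_free_point; apply: filterS => x xfree _.
  have [Cfin /andP[C0 Cn]] :=
    card_class_translates _ _ actG theta_eq _ _ xfree thetan.
  rewrite esum_indic// ?mulr_ge0//.
  by rewrite w_class// mulrCA mulfV ?mulr1// pnatr_eq0 -lt0n.
rewrite (mass_transport mu act)//.
(* As [mu] has mass 1, the profile is the integral of a constant, to be compared with the mass
   received at free points. *)
rewrite -[leLHS]mule1 -(probability_setT mu) -integral_cst//.
apply: ae_ge0_le_integral => //.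
- by move=> x _; exact: esum_ge0.
- apply: measurable_esum => // g; apply: measurableT_comp => //.
  exact: (act_mp g).1.
move: ae_free_point; apply: filterS => x xfree _.
have [Cfin Cn] :=
    card_class_translates _ _ actG theta_eq _ _ xfree thetan.
under eq_esum do rewrite fE.
rewrite esum_indic//; last first.
  by apply: sub_finite_set Cfin => g [].
(* The mass received becomes the boundary ratio of F_x, a competitor in the infimum. *)
rewrite -fboundary_class_translates// w_class//.
by apply: ereal_inf_lbound; exists (fset_set (C x)).
Qed.

End averaging.

Theorem proposition5p1 (R : realType) (G : groupType) (S : {fset G})
    (d : measure_display) (X : measurableType d) (mu : probability X R)
    (act : G -> X -> X)
    (Ssym : symmetric_set S) (Sgen : generating_set S)
    (Xstd : standard_borel R X)
    (actG : group_action act)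
    (act_mp : measure_preserving_action mu act)
    (act_free : essentially_free mu act) :
  \forall n \near \oo, (group_profile R S n <= action_profile mu act S n)%E.
Proof.
have Gcount := generating_countable _ _ Ssym Sgen.
apply: nearW => n; apply: le_ereal_inf_tmp => _ [theta [theta_sub thetan] <-].
exact: group_profile_le_boundary.
Qed.
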